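(* Let $A$ be a Banach algebra and let $X$ be a linear, closed, $A$-left invariant subspace of $A^\ast$ such that $X^\ast\cdot X\subseteq X$ and such that $X^\ast$, with the product $\langle m\cdot n,f\rangle=\langle m,n\cdot f\rangle$ ($m,n\in X^\ast$, $f\in X$), is a Banach algebra. Suppose $Hom(A,\mathbb{C})\subseteq X$ and let $\varphi\in Hom(A,\mathbb{C})$. If $X$ is $\varphi$-left amenable with a unique $\varphi$-mean $m_\varphi$, then $m_\varphi\in Z(X^\ast)$.
   Context: $A^\ast$ is the Banach space dual of $A$, and $Hom(A,\mathbb{C})\subseteq A^\ast$ is the set of all nonzero homomorphisms from $A$ into $\mathbb{C}$. For $f\in A^\ast$, $a\in A$, $f\cdot a\in A^\ast$ is defined by $\langle f\cdot a,b\rangle=\langle f,ab\rangle$ ($b\in A$). A subspace $X\subseteq A^\ast$ is $A$-left invariant if $f\cdot a\in X$ for all $f\in X$, $a\in A$. For such $X$, $m\in X^\ast$ and $f\in X$, the functional $m\cdot f\in A^\ast$ is defined by $\langle m\cdot f,a\rangle=\langle m,f\cdot a\rangle$ ($a\in A$); $X^\ast\cdot X\subseteq X$ means $m\cdot f\in X$ for all $m\in X^\ast$, $f\in X$. $X$ is $\varphi$-left amenable if there exists $m_\varphi\in X^\ast$, called a $\varphi$-mean on $X$, such that (i) $m_\varphi(\varphi)=1$ and (ii) $m_\varphi(f\cdot a)=\varphi(a)m_\varphi(f)$ for every $f\in X$ and $a\in A$. The topological centre of $X^\ast$ is $Z(X^\ast)=\{m\in X^\ast:\ \text{the map } n\mapsto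 m\cdot n \text{ is } w^\ast\text{-}w^\ast \text{ continuous on } X^\ast\}$, where $w^\ast$ is the weak-star topology $\sigma(X^\ast,X)$. *)

(* Defs.v *)
From HB Require Import structures.
From mathcomp Require Import all_boot all_order all_algebra.
From mathcomp Require Import complex.
From mathcomp Require Import all_classical all_reals all_analysis.

Set Implicit Arguments.
Unset Strict Implicit.
Unset Printing Implicit Defensive.

Import Order.TTheory GRing.Theory Num.Theory.
Import numFieldNormedType.Exports.

Local Open Scope classical_set_scope.
Local Open Scope ring_scope.

Section Dual.
Context {R : realType} (V : normedModType R[i]).

Definition dual_pred : {pred V -> R[i]^o} :=
  [pred f : V -> R[i]^o | `[< linear f /\ continuous f >]].

Lemma dual_pred_submod : submod_closed dual_pred.
Proof.
split.
  apply/asboolP; split; first by move=> k x y /=; rewrite scaler0 addr0.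
  exact: cst_continuous.
move=> k f g /asboolP[lf cf] /asboolP[lg cg]; apply/asboolP; split.
  move=> l x y; rewrite !fctE lf lg !scalerDr !scalerA mulrC.
  by rewrite -!addrA; congr (_ + _); rewrite addrCA.
move=> x; apply: (@continuousD _ _ _ (k *: f) g x); last exact: cg.
by apply: continuousZr; exact: cf.
Qed.

HB.instance Definition _ := GRing.isSubmodClosed.Build _ _ dual_pred
  dual_pred_submod.

Record dual := Dual { dual_val :> V -> R[i]^o; _ : dual_val \in dual_pred }.

HB.instance Definition _ := [isSub for dual_val].
HB.instance Definition _ := [Choice of dual by <:].
HB.instance Definition _ := [SubChoice_isSubLmodule of dual by <:].

Lemma dual_linear (f : dual) : linear f.
Proof. by case: f => f /= /asboolP[]. Qed.

Lemma dual_continuous (f : dual) : continuous f.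
Proof. by case: f => f /= /asboolP[]. Qed.

HB.instance Definition _ (f : dual) :=
  GRing.isLinear.Build R[i] V R[i]^o *:%R (dual_val f) (dual_linear f).

Lemma dualP (f g : dual) : f =1 g -> f = g.
Proof. by move=> fg; apply/val_inj/funext. Qed.

Lemma dual_scaleD (k : R[i]) (f g : dual) x : (k *: f + g) x = k * f x + g x.
Proof. by []. Qed.

(* The norm of a normedModType over R[i] takes its values in R[i], whence the
   detour through the real part to take the supremum. *)
Definition dual_norm (f : dual) : R[i] :=
  (sup [set complex.Re `|f x| | x in [set x : V | `|x| <= 1]])%:C%C.

Lemma Re_normC (W : normedZmodType R[i]) (x : W) :
  (complex.Re `|x|)%:C%C = `|x|.
Proof. exact/RRe_real/normr_real. Qed.

Lemma dual_bounded (f : dual) :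
  exists2 M : R, 0 <= M & forall x, `|f x| <= M%:C%C * `|x|.
Proof.
have /linear_bounded_continuous/linear_boundedP := @dual_continuous f.
move=> /pinfty_ex_gt0[M M0 fM]; exists (complex.Re M) => [|x].
  by rewrite -lecR RRe_real ?gtr0_real// ltW.
rewrite RRe_real ?gtr0_real//; exact: fM.
Qed.

Lemma dual_norm_has_sup (f : dual) :
  has_sup [set complex.Re `|f x| | x in [set x : V | `|x| <= 1]].
Proof.
split; first by exists (complex.Re `|f 0|), 0 => //=; rewrite normr0 ler01.
have [M M0 fM] := dual_bounded f; exists M => _ [x x1 <-].
by rewrite -lecR Re_normC (le_trans (fM x))// ler_piMr// lecR.
Qed.

Lemma dual_norm_ge0 (f : dual) : 0 <= dual_norm f.
Proof.
rewrite lecR; apply: (@le_trans _ _ (complex.Re `|f 0|)).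
  by rewrite -lecR Re_normC normr_ge0.
apply: sup_upper_bound; first exact: dual_norm_has_sup.
by exists 0; rewrite //= normr0 ler01.
Qed.

Lemma dual_normP (f : dual) (x : V) : `|f x| <= dual_norm f * `|x|.
Proof.
have [->|x0] := eqVneq x 0; first by rewrite linear0 !normr0 mulr0.
have nx0 : 0 < `|x| by rewrite normr_gt0.
rewrite -ler_pdivrMr// mulrC.
have -> : `|x|^-1 * `|f x| = `|f (`|x|^-1 *: x)|.
  by rewrite linearZ/= normrM normfV normr_id.
rewrite -Re_normC lecR; apply: sup_upper_bound; first exact: dual_norm_has_sup.
by exists (`|x|^-1 *: x) => //=; rewrite normfZV.
Qed.

Lemma dual_norm_le (f : dual) (M : R[i]) : 0 <= M ->
  (forall x, `|f x| <= M * `|x|) -> dual_norm f <= M.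
Proof.
move=> M0 fM; rewrite -[M](RRe_real (ger0_real M0)) lecR.
apply: ge_sup; first by case: (dual_norm_has_sup f).
move=> _ [x x1 <-]; rewrite -lecR Re_normC RRe_real ?ger0_real//.
by rewrite (le_trans (fM x))// ler_piMr.
Qed.

Lemma dual_normD (f g : dual) :
  dual_norm (f + g) <= dual_norm f + dual_norm g.
Proof.
apply: dual_norm_le => [|x]; first by rewrite addr_ge0 ?dual_norm_ge0.
by rewrite mulrDl (le_trans (ler_normD _ _))// lerD ?dual_normP.
Qed.

Lemma dual_normZ (k : R[i]) (f : dual) :
  dual_norm (k *: f) = `|k| * dual_norm f.
Proof.
have le_normZ (l : R[i]) g : dual_norm (l *: g) <= `|l| * dual_norm g.
  apply: dual_norm_le => [|x]; first by rewrite mulr_ge0 ?dual_norm_ge0.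
  by rewrite -mulrA normrM ler_wpM2l ?dual_normP.
have [->|k0] := eqVneq k 0.
  apply/eqP; rewrite eq_le le_normZ normr0 mul0r dual_norm_ge0.
  by [].
apply/eqP; rewrite eq_le le_normZ/= -ler_pdivlMl ?normr_gt0// -normfV.
by rewrite -{1}[f](scalerK k0) le_normZ.
Qed.

Lemma dual_norm0_eq0 (f : dual) : dual_norm f = 0 -> f = 0.
Proof.
move=> f0; apply: dualP => x; apply/eqP; rewrite -normr_le0.
by rewrite (le_trans (dual_normP f x))// f0 mul0r.
Qed.

HB.instance Definition _ :=
  Lmodule_isNormed.Build R[i] dual dual_normD dual_normZ dual_norm0_eq0.

Lemma bounded_dual_pred (f : V -> R[i]^o) (M : R[i]) :
  linear f -> 0 <= M -> (forall x, `|f x| <= M * `|x|) -> f \in dual_pred.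
Proof.
move=> lf M0 fM; apply/asboolP; split=> //.
pose lfM := GRing.isLinear.Build R[i] V R[i]^o *:%R f lf.
pose g : {linear V -> R[i]^o} := HB.pack f lfM.
apply: (@bounded_linear_continuous _ _ _ g); apply/linear_boundedP.
near=> r => x; rewrite (le_trans (fM x))// ler_wpM2r//.
by near: r; apply: nbhs_pinfty_ge; exact: ger0_real.
Unshelve. all: by end_near. Qed.

(* sigma(V^*, V), as the topology induced by pointwise convergence on V *)
Definition weak_star : Type :=
  initial_topology (fun m : dual => dual_val m : {ptws V -> R[i]^o}).

HB.instance Definition _ := Topological.copy weak_star
  (initial_topology (fun m : dual => dual_val m : {ptws V -> R[i]^o})).

End Dual.

Arguments dual_pred {R} V.

Section Submod.
Context {K : numFieldType} {V : normedModType K} (X : submodClosed V).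

Record submod := Submod { submod_val :> V; _ : submod_val \in X }.

HB.instance Definition _ := [isSub for submod_val].
HB.instance Definition _ := [Choice of submod by <:].
HB.instance Definition _ := [SubChoice_isSubLmodule of submod by <:].

Definition submod_norm (x : submod) : K := `|val x|.

Lemma submod_normD x y : submod_norm (x + y) <= submod_norm x + submod_norm y.
Proof. exact: ler_normD. Qed.

Lemma submod_normZ (k : K) x : submod_norm (k *: x) = `|k| * submod_norm x.
Proof. exact: normrZ. Qed.

Lemma submod_norm0_eq0 x : submod_norm x = 0 -> x = 0.
Proof. by move=> /normr0_eq0 x0; exact: val_inj. Qed.

HB.instance Definition _ :=
  Lmodule_isNormed.Build K submod submod_normD submod_normZ submod_norm0_eq0.

End Submod.

(* Banach algebras are not required to have a unit, so that the multiplication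
   cannot come from one of the ring structures. *)

Record banach_product {K : numFieldType} {V : normedModType K}
    (mul : V -> V -> V) : Prop := BanachProduct {
  banach_mulA : associative mul;
  banach_linearl : forall b, linear (mul^~ b);
  banach_linearr : forall a, linear (mul a);
  banach_normM : forall a b, `|mul a b| <= `|a| * `|b|
}.

Definition is_banach_algebra {K : numFieldType} (V : normedModType K)
    (mul : V -> V -> V) : Prop :=
  (forall F : set_system V, ProperFilter F -> cauchy F -> cvg F) /\
  banach_product mul.

HB.mixin Record isBanachAlgebra (K : numFieldType) A
    & CompleteNormedModule K A := {
  bmul : A -> A -> A;
  bmulP : banach_product bmul
}.

#[short(type="banachAlgType")]
HB.structure Definition BanachAlgebra (K : numFieldType) :=
  {A of CompleteNormedModule K A & isBanachAlgebra K A}.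

Section Actions.
Context {R : realType} {A : banachAlgType R[i]}.

Definition dual_act_fun (f : dual A) (a : A) : A -> R[i]^o :=
  fun b => f (bmul a b).

Lemma dual_act_subproof f a : dual_act_fun f a \in dual_pred A.
Proof.
apply: (@bounded_dual_pred _ _ _ (`|f| * `|a|)) => [k x y||x].
- by rewrite /dual_act_fun (banach_linearr bmulP) linearP.
- by rewrite mulr_ge0.
- rewrite (le_trans (dual_normP _ _))// -mulrA ler_wpM2l ?dual_norm_ge0//.
  exact: (banach_normM bmulP).
Qed.

Definition dual_act (f : dual A) (a : A) : dual A :=
  Dual (dual_act_subproof f a).

Lemma dual_act_norm f a : `|dual_act f a| <= `|f| * `|a|.
Proof.
apply: dual_norm_le => [|x]; first by rewrite mulr_ge0.
rewrite (le_trans (dual_normP f (bmul a x)))// -mulrA ler_wpM2l ?dual_norm_ge0//.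
exact: (banach_normM bmulP).
Qed.

Definition left_invariant (X : submodClosed (dual A)) : Prop :=
  forall f a, f \in X -> dual_act f a \in X.

(* The homomorphisms of a Banach algebra into the scalars are automatically
   continuous, so that Hom(A, C) is a subset of the dual. *)
Definition HomC : set (dual A) :=
  [set psi : dual A | psi != 0 /\
    forall a b, psi (bmul a b) = (psi a : R[i]) * (psi b : R[i])].

Section Submodule.
Context {X : submodClosed (dual A)} (Xinv : left_invariant X).

Definition sub_act (f : submod X) (a : A) : submod X :=
  Submod (Xinv a (valP f)).

Lemma sub_act_linear a : linear (sub_act^~ a).
Proof.
move=> k f g; apply/val_inj/dualP => b.
by rewrite /= /dual_act_fun.
Qed.

Definition mean_act_fun (m : dual (submod X)) (f : submod X) : A -> R[i]^o :=
  fun a => m (sub_act f a).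

Lemma mean_act_subproof m f : mean_act_fun m f \in dual_pred A.
Proof.
apply: (@bounded_dual_pred _ _ _ (`|m| * `|f|)) => [k a b||a].
- rewrite /mean_act_fun -linearP; congr (m _); apply/val_inj/dualP => c /=.
  by rewrite /dual_act_fun (banach_linearl bmulP) linearP.
- by rewrite mulr_ge0.
- rewrite (le_trans (dual_normP _ _))// -mulrA ler_wpM2l ?dual_norm_ge0//.
  exact: dual_act_norm.
Qed.

Definition mean_act (m : dual (submod X)) (f : submod X) : dual A :=
  Dual (mean_act_subproof m f).

Lemma mean_act_norm m f : `|mean_act m f| <= `|m| * `|f|.
Proof.
apply: dual_norm_le => [|a]; first by rewrite mulr_ge0.
rewrite (le_trans (dual_normP m (sub_act f a)))// -mulrA ler_wpM2l ?dual_norm_ge0//.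
exact: dual_act_norm.
Qed.

Lemma mean_act_linear m : linear (mean_act m).
Proof.
move=> k f g; apply: dualP => a; rewrite dual_scaleD /= /mean_act_fun.
by rewrite sub_act_linear linearP.
Qed.

(* X^* . X is included in X *)
Definition introverted : Prop := forall m f, mean_act m f \in X.

Definition phi_mean (phi : dual A) (phi_X : phi \in X)
    (m : dual (submod X)) : Prop :=
  m (Submod phi_X) = 1 /\
  forall f a, m (sub_act f a) = (phi a : R[i]) * (m f : R[i]).

Definition left_amenable (phi : dual A) (phi_X : phi \in X) : Prop :=
  exists m, phi_mean phi_X m.

Section ArensProduct.
Variable Xintro : introverted.

Definition arens_fun (m n : dual (submod X)) : submod X -> R[i]^o :=
  fun f => m (Submod (Xintro n f)).

Lemma arens_subproof m n : arens_fun m n \in dual_pred (submod X).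
Proof.
apply: (@bounded_dual_pred _ _ _ (`|m| * `|n|)) => [k f g||f].
- rewrite /arens_fun -linearP; congr (m _); apply: val_inj.
  exact: mean_act_linear.
- by rewrite mulr_ge0.
- rewrite (le_trans (dual_normP _ _))// -mulrA ler_wpM2l ?dual_norm_ge0//.
  exact: mean_act_norm.
Qed.

Definition arens (m n : dual (submod X)) : dual (submod X) :=
  Dual (arens_subproof m n).

Definition topological_centre : set (dual (submod X)) :=
  [set m | continuous
    (arens m : weak_star (submod X) -> weak_star (submod X))].

End ArensProduct.
End Submodule.
End Actions.

Arguments HomC {R} A.

(* Main.v *)
(** For a mean [m] and [n] in X^*, the functional [m . n] satisfies condition
(ii) and takes the value [n phi] at [phi]; hence [m . n + (1 - n phi) m] is
again a mean. Uniqueness forces [m . n = (n phi) m], and the right-hand side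
depends w*-continuously on [n]. *)
Require Import Defs.
From mathcomp Require Import all_boot all_order all_algebra.
From mathcomp Require Import complex.
From mathcomp Require Import all_classical all_reals all_analysis.
Import numFieldNormedType.Exports.
Local Open Scope classical_set_scope.
Local Open Scope ring_scope.

(** Evaluation at [x] factors as the map into [{ptws V -> R[i]^o}] inducing the topology, followed
    by the coordinate projection at [x]. *)
Lemma weak_star_eval_continuous (R : realType) (V : normedModType R[i])
    (x : V) :
  continuous ((fun n : dual V => n x) : weak_star V -> R[i]^o).
Proof.
move=> n.
have nV := @initial_continuous _ _
  (fun m : dual V => dual_val m : {ptws V -> R[i]^o}) n.
exact: (continuous_comp nV (@proj_continuous V (fun=> R[i]^o) x _)).
Qed.

(** The target carries an initial topology, and convergence in [{ptws V -> R[i]^o}] is tested one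
    point at a time. *)
Lemma continuous_weak_star (R : realType) (T : topologicalType)
    (V : normedModType R[i]) (F : T -> dual V) :
  (forall x, continuous ((fun t => F t x) : T -> R[i]^o)) ->
  continuous (F : T -> weak_star V).
Proof.
move=> cF; apply: continuous_comp_initial => t.
by apply/pointwise_cvgP => x; exact: cF.
Qed.

Section Means.
Import GRing.Theory.
Context {R : realType} {A : banachAlgType R[i]} {X : submodClosed (dual A)}.
Context {X_inv : left_invariant X} (X_intro : introverted X_inv).

(** Associativity of [bmul] gives [(f . a) . b = f . (a b)], so both sides send [b] to
    [n (f . (a b))]. *)
Lemma mean_act_sub_act (n : dual (submod X)) (f : submod X) (a : A) :
  mean_act X_inv n (sub_act X_inv f a) = dual_act (mean_act X_inv n f) a.
Proof.
apply: dualP => b; congr (n _); apply/val_inj/dualP => c /=.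
by rewrite /dual_act_fun /= /dual_act_fun (banach_mulA bmulP).
Qed.

(** Multiplicativity of [phi] means [phi . a = phi(a) phi], and [n] is linear. *)
Lemma mean_act_hom {phi : dual A} (phi_X : phi \in X)
    (n : dual (submod X)) : HomC A phi ->
  mean_act X_inv n (Submod phi_X) = (n (Submod phi_X) : R[i]) *: phi.
Proof.
move=> [_ phiM]; apply: dualP => a.
transitivity (n ((phi a : R[i]) *: Submod phi_X)); last first.
  by rewrite linearZ; exact: mulrC.
by congr (n _); apply/val_inj/dualP => b; exact: phiM.
Qed.

(** Since [n . (f . a) = (n . f) . a], this is condition (ii) for [m] at the element [n . f] of
    [X]. *)
Lemma arens_mean_eigen {phi : dual A} {phi_X : phi \in X}
    {m : dual (submod X)} (n : dual (submod X)) (f : submod X) (a : A) :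
  phi_mean X_inv phi_X m ->
  arens X_intro m n (sub_act X_inv f a) =
  (phi a : R[i]) * (arens X_intro m n f : R[i]).
Proof.
move=> [_ mE]; rewrite -[RHS]mE; congr (m _); apply: val_inj.
exact: mean_act_sub_act.
Qed.

Lemma arens_mean_hom {phi : dual A} {phi_X : phi \in X}
    {m : dual (submod X)} (n : dual (submod X)) :
  HomC A phi -> phi_mean X_inv phi_X m ->
  arens X_intro m n (Submod phi_X) = n (Submod phi_X).
Proof.
move=> phiH [m1 _].
transitivity (m ((n (Submod phi_X) : R[i]) *: Submod phi_X)); last first.
  by rewrite linearZ /= m1; exact: mulr1.
by congr (m _); apply: val_inj; exact: mean_act_hom.
Qed.

Lemma arens_unique_mean {phi : dual A} {phi_X : phi \in X}
    {m : dual (submod X)} (n : dual (submod X)) :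
  HomC A phi -> phi_mean X_inv phi_X m ->
  (forall m', phi_mean X_inv phi_X m' -> m' = m) ->
  arens X_intro m n = (n (Submod phi_X) : R[i]) *: m.
Proof.
move=> phiH mP m_unique; set c := (n _ : R[i]).
have [m1 mE] := mP.
suff /m_unique E : phi_mean X_inv phi_X ((1 - c) *: m + arens X_intro m n).
  (* Adding [(1 - c) m] turns the left side into [m] by [E], and [c m] into [m] by linearity. *)
  apply: (addrI ((1 - c) *: m)).
  by rewrite E -scalerDl subrK scale1r.
split=> [|f a]; rewrite !dual_scaleD.
  by rewrite (arens_mean_hom n phiH mP) m1 mulr1 subrK.
by rewrite (arens_mean_eigen n f a mP) mE mulrDr mulrCA.
Qed.

End Means.

Theorem theorem3p10 (R : realType) (A : banachAlgType R[i])
    (X : submodClosed (dual A))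
    (X_closed : closed [set f : dual A | f \in X])
    (X_inv : left_invariant X)
    (X_intro : introverted X_inv)
    (X_banach : is_banach_algebra (arens X_intro))
    (X_Hom : forall psi : dual A, HomC A psi -> psi \in X)
    (phi : dual A) (phi_Hom : HomC A phi)
    (X_amenable : left_amenable X_inv (X_Hom phi phi_Hom))
    (m : dual (submod X))
    (m_mean : phi_mean X_inv (X_Hom phi phi_Hom) m)
    (m_unique : forall m' : dual (submod X),
      phi_mean X_inv (X_Hom phi phi_Hom) m' -> m' = m) :
  topological_centre X_intro m.
Proof.
apply: continuous_weak_star => f.
(* At a fixed [f] the map becomes [n |-> n(phi) m(f)]: a weak-star continuous evaluation times a
   constant. *)
under eq_fun do rewrite (arens_unique_mean X_intro _ phi_Hom m_mean m_unique).
move=> n.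
apply: (@continuousM _ _ (fun k : weak_star _ => k _ : R[i]^o) (cst (m f))).
  exact: weak_star_eval_continuous.
exact: cst_continuous.
Qed.
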